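(* Let $R$ be a field, $P$ a set and $\Pi=\prod_{x\in P}Re_x$. The following are equivalent: (1) Every $\eta\in\operatorname{End}(\Pi)$ is induced. (2) $|P|<\mu_R$.
   Context: $\Pi=\prod_{x\in P}Re_x$ is the full cartesian product of $|P|$ copies of $R$, an $R$-algebra with componentwise operations; its elements are written $a=\sum_{x\in P}a_xe_x$ with arbitrary $a_x\in R$. For $X\subseteq P$, $e_X=\sum_{x\in X}e_x$. $\operatorname{End}(\Pi)$ is the set of $R$-algebra endomorphisms of $\Pi$ ($R$-linear multiplicative maps, not necessarily unital). An $\eta\in\operatorname{End}(\Pi)$ is induced if there is a family $\{A_x:x\in P\}$ of pairwise disjoint (possibly empty) subsets of $P$ such that $\eta\left(\sum_{x\in P}a_xe_x\right)=\sum_{x\in P}a_xe_{A_x}$ for all $\sum_{x\in P}a_xe_x\in\Pi$ (the element whose $y$-coordinate is $a_x$ if $y\in A_x$ and $0$ if $y\notin\bigcup_{x}A_x$). Cardinal $\mu_R$: if $R$ is finite, $\mu_R=\aleph_0$. If $R$ is infinite, $\mu_R$ is the least cardinal $\kappa$ such that a set of cardinality $\kappa$ carries a nontrivial $|R|^+$-additive measure $\mu$ with values in $\{0,1\}$ defined on all subsets (nontrivial: the whole set has measure $1$ and every singleton has measure $0$; $|R|^+$-additive: $\mu(\bigcup_{i\in I}X_i)=\sum_{i\in I}\mu(X_i)$ for pairwise disjoint families with $|I|\le|R|$); equivalently, such that it carries a non-principal $|R|^+$-complete ultrafilter. If no such cardinal exists, $\mu_R=\infty$ and $|P|<\mu_R$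 holds for every set $P$. *)

(* Defs.v *)
From HB Require Import structures.
From mathcomp Require Import all_boot all_order all_algebra.
From mathcomp Require Import all_classical all_reals ereal esum.
From mathcomp Require Import Rstruct.

Set Implicit Arguments.
Unset Strict Implicit.
Unset Printing Implicit Defensive.

Import Order.TTheory GRing.Theory Num.Theory.

Local Open Scope classical_set_scope.
Local Open Scope card_scope.
Local Open Scope ring_scope.

(* The R-algebra Pi is the function type P -> R^o, with the pointwise ring and
   R-module structures of mathcomp.classical.functions; R^o is R itself, seen
   as a module over R.
   Endomorphisms are R-linear and multiplicative, but need not preserve 1. *)
Record algEnd (R : fieldType) (P : Type) := AlgEnd {
  algEnd_fun :> {linear (P -> R^o) -> (P -> R^o)};
  algEnd_mul : {morph algEnd_fun : a b / a * b}
}.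

(* The infinite sum \sum_x a_x e_{A_x} is given by its coordinates, which are
   well defined because the A_x are pairwise disjoint. *)
Definition induced (R : fieldType) (P : Type) (eta : algEnd R P) : Prop :=
  exists A : P -> set P,
    trivIset [set: P] A /\
    forall (a : P -> R^o) (y : P),
      (forall x, A x y -> eta a y = a x) /\
      (~ (\bigcup_x A x) y -> eta a y = 0).

Definition card_lt (T U : Type) : Prop :=
  ([set: T] #<= [set: U]) /\ ~ ([set: T] #= [set: U]).

(* A nontrivial kappa^+-additive {0,1}-valued measure on all subsets of T,
   where kappa = |K|.  The sum over the index set I is the unordered sum of
   nonnegative extended reals. *)
Definition nontrivial_succ_additive_measure (K T : Type)
    (mu : set T -> \bar Rdefinitions.R) : Prop :=
  [/\ forall X, mu X = 0%E \/ mu X = 1%E,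
      mu [set: T] = 1%E,
      forall t, mu [set t] = 0%E
    & forall (J : choiceType) (I : set J) (X : J -> set T),
        (I #<= [set: K]) -> trivIset I X ->
        mu (\bigcup_(i in I) X i) = \esum_(i in I) mu (X i)].

Definition carries_measure (K T : Type) : Prop :=
  exists mu : set T -> \bar Rdefinitions.R,
    nontrivial_succ_additive_measure K mu.

(* Cardinals are represented by types: [is_mu R M] says that mu_R is not
   infinity and |M| = mu_R; mu_R = infinity when no M satisfies it. *)
Definition is_mu (R : fieldType) (M : Type) : Prop :=
  (finite_set [set: R] -> ([set: M] #= [set: nat])) /\
  (infinite_set [set: R] ->
     carries_measure R M /\
     forall N : Type, carries_measure R N -> ([set: M] #<= [set: N])).

(* |P| < mu_R, vacuously true when mu_R = infinity. *)
Definition card_lt_mu (P : Type) (R : fieldType) : Prop :=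
  forall M : Type, is_mu R M -> card_lt P M.

(* Main.v *)
(* For each coordinate [y], [a |-> eta a y] is an algebra map [Pi -> R]: it is
   zero, a coordinate projection, or else the limit along a nonprincipal filter
   [U = {X | eta e_X y = 1}] for which every [a : P -> R] is constant on a
   member of [U].  Indeed if [a] takes the value [r = eta a y] only on [Z], then
   [a - r] is invertible off [Z], so [e_{~Z}] is killed and [Z] lies in [U].
   Conversely such a [U] gives the endomorphism sending [a] to the constant
   [lim_U a], which is not induced.  Thus all endomorphisms are induced iff
   there is no such [U] on [P].  If [R] is finite such a [U] is an arbitrary
   nonprincipal ultrafilter; in general it amounts to an |R|^+-additive measure,
   by taking [a] to be the function that indexes the pieces of a partition. *)

Require Import Defs.
From mathcomp Require Import all_boot all_order all_algebra.
From HB Require Import structures.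
From mathcomp Require Import all_classical all_reals esum.
From mathcomp Require Import Rstruct.

Set Implicit Arguments.
Unset Strict Implicit.
Unset Printing Implicit Defensive.

Import Order.TTheory GRing.Theory Num.Theory.

Local Open Scope classical_set_scope.
Local Open Scope card_scope.
Local Open Scope ring_scope.

(** * Comparing cardinals of types by injections *)

Lemma inj_card_leT (T U : Type) (f : T -> U) :
  injective f -> [set: T] #<= [set: U].
Proof.
move=> finj; have [g] : $|{injfun [set: T] >-> [set: U]}|.
  by apply/injfunPex; exists f => // x y _ _; apply: finj.
exact: inj_card_le g.
Qed.

Lemma card_le_inj (T U : Type) (A : set T) : A #<= [set: U] ->
  exists f : A -> U, injective f.
Proof.
move=> /card_leP[g]; exists (fun x => val (g x)) => x y.
by move=> /val_inj /(@inj _ _ _ g); rewrite !inE; apply.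
Qed.

Lemma card_leT_inj (T U : Type) : [set: T] #<= [set: U] ->
  exists f : T -> U, injective f.
Proof.
move=> /card_le_inj[f finj]; exists (fun x => f (SigSub (mem_setT x))) => x y.
by move=> /finj[].
Qed.

(* A maximal family of pairwise everywhere distinct choice functions must
   project onto some [T i]. *)
Lemma card_le_min (I : Type) (i0 : I) (T : I -> Type) :
  exists i, forall j, [set: T i] #<= [set: T j].
Proof.
pose D (A : set (forall i, T i)) :=
  forall f g, A f -> A g -> forall i, f i = g i -> f = g.
have [F FD Ftot|A [DA maxA]] := @Zorn_bigcup _ D.
  move=> f g [X FX Xf] [Y FY Yg] i fg.
  have [XY|YX] := Ftot _ _ FX FY.
    by apply: (FD _ FY) fg => //; apply: XY.
  by apply: (FD _ FX) fg => //; apply: YX.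
(* Otherwise every [T i] has a value that no member of [A] takes at [i]; these values form a
   function [g] that could be added to [A], against maximality. *)
have [i surjA] : exists i, forall t, exists f, A f /\ f i = t.
  apply: contrapT => /forallNP nsurj.
  have missed i : {t : T i | forall f, A f -> f i <> t}.
    apply: cid; have /existsNP[t /forallNP nt] := nsurj i.
    by exists t => f Af ft; apply: (nt f).
  pose g i := projT1 (missed i).
  have gP i f : A f -> f i <> g i by exact: (projT2 (missed i)).
  apply: (maxA (A `|` [set g])).
    split=> [f|sub]; first by left.
    by apply: (gP i0 g) => //; apply: sub; right.
  move=> f h [Af|->] [Ah|->] i // e; first exact: DA e.
    by have := gP i _ Af.
  by have := gP i _ Ah; rewrite e.
exists i => j.
have [s sP] := choice surjA.
(* [s t] is a member of [A] with value [t] at [i]. Two members that agree at [j] are equal, hence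
   agree at [i]. *)
apply: (@inj_card_leT _ _ (fun t => s t j)) => t t' e.
have [[As <-] [As' <-]] := (sP t, sP t').
by rewrite (DA _ _ As As' _ e).
Qed.

Lemma card_le_total (T U : Type) :
  [set: T] #<= [set: U] \/ [set: U] #<= [set: T].
Proof.
have [b bP] := card_le_min true (fun b : bool => if b then T else U).
by case: b bP => /= bP; [left; apply: (bP false)|right; apply: (bP true)].
Qed.

Lemma esum_unique (K : realType) (J : choiceType) (I : set J)
    (a : J -> \bar K) (i : J) :
  I i -> (0 <= a i)%E -> (forall j, I j -> j <> i -> a j = 0%E) ->
  \esum_(j in I) a j = a i.
Proof.
move=> Ii ai0 a0.
have a_ge0 j : I j -> (0 <= a j)%E.
  by move=> Ij; have [->//|ji] := pselect (j = i); rewrite a0.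
rewrite (esumID [set i])// (_ : I `&` [set i] = [set i]); last first.
  by apply/seteqP; split=> [j []//|j ->]; split.
by rewrite esum_set1// esum1 ?adde0// => j [Ij /= ji]; exact: a0.
Qed.

(* On an ultrafilter [U], the last condition is |R|^+-completeness. *)
Definition nonprincipal_decisive (R P : Type) (U : set_system P) : Prop :=
  [/\ ProperFilter U,
      forall x, ~ U [set x]
    & forall a : P -> R, exists r, U (a @^-1` [set r])].

(** * The endomorphism given by limits along a decisive filter *)

Section LimitEndomorphism.
Variables (R : fieldType) (P : Type) (U : set_system P).
Hypothesis Udec : nonprincipal_decisive R U.

Let Udecided (a : P -> R) : exists r, U (a @^-1` [set r]).
Proof. by case: Udec. Qed.

Definition ulim (a : P -> R) : R := projT1 (cid (Udecided a)).

Lemma ulimP a : U [set x | a x = ulim a].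
Proof. exact: (projT2 (cid (Udecided a))). Qed.

Lemma ulim_eq a r : U [set x | a x = r] -> ulim a = r.
Proof.
case: Udec => FU _ _ Ur; apply: contrapT => ne; apply: (filter_not_empty U).
by apply: filterS (filterI (ulimP a) Ur) => x [/= -> ].
Qed.

Definition ulim_const (a : P -> R^o) : P -> R^o := fun=> ulim a.

Lemma ulim_const_linear : linear ulim_const.
Proof.
case: Udec => FU _ _ k a b; apply/funext => y; apply: ulim_eq.
by apply: filterS (filterI (ulimP a) (ulimP b)) => x [/= ax bx];
rewrite /ulim_const !fctE -?ax -?bx.
Qed.

Lemma ulim_const_mul : {morph ulim_const : a b / a * b}.
Proof.
case: Udec => FU _ _ a b; apply/funext => y; apply: ulim_eq.
by apply: filterS (filterI (ulimP a) (ulimP b)) => x [/= ax bx];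
rewrite /ulim_const !fctE -?ax -?bx.
Qed.

HB.instance Definition _ :=
  GRing.isLinear.Build R (P -> R^o) (P -> R^o) _ ulim_const ulim_const_linear.

(** Properness of [U] provides a point [y]. If [y] lies in some [A x], testing on [e_x] gives limit
    1 and puts the singleton of [x] in [U]; if [y] lies in no [A x], testing on the constant 1 gives
    limit 0. *)
Lemma ulim_const_not_induced :
  ~ induced (@AlgEnd R P ulim_const ulim_const_mul).
Proof.
case: Udec => FU Unp _ [A [_ Aind]].
have [y _] := filter_ex (@filterT _ U _).
have [[x _ Axy]|nA] := pselect ((\bigcup_x A x) y).
  pose e_x z : R := if pselect (z = x) then 1 else 0.
  have lim1 : ulim e_x = 1.
    have := (Aind e_x y).1 x Axy; rewrite /= /ulim_const => ->.
    by rewrite /e_x; case: pselect.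
  apply: (Unp x).
  apply: filterS (ulimP e_x) => z /=; rewrite lim1 /e_x.
  by case: pselect => // _ /esym/eqP; rewrite oner_eq0.
have := (Aind (cst 1) y).2 nA; rewrite /= /ulim_const.
rewrite (@ulim_eq _ 1) => [/eqP|]; first by rewrite oner_eq0.
exact: filterS filterT.
Qed.

End LimitEndomorphism.

(** * Coordinates of an endomorphism *)

Section Coordinate.
Variables (R : fieldType) (P : Type) (eta : algEnd R P) (y : P).

Definition indic (X : set P) : P -> R^o := fun x => if x \in X then 1 else 0.

Let phi (a : P -> R^o) : R := eta a y.

Let phiB a b : phi (a - b) = phi a - phi b.
Proof. by rewrite /phi linearB. Qed.

Let phiZ (r : R) a : phi (r *: a) = r * phi a.
Proof. by rewrite /phi linearZ. Qed.

Let phiM a b : phi (a * b) = phi a * phi b.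
Proof. by rewrite /phi algEnd_mul. Qed.

Let indicM X a : indic X * a = fun x => if x \in X then a x else 0.
Proof.
by apply/funext => x; rewrite mulrfctE /indic; case: ifP; rewrite ?mul1r ?mul0r.
Qed.

Hypothesis phi_neq0 : exists a, phi a != 0.

(** Unitality is recovered by cancelling a nonzero [phi a] in [phi 1 * phi a = phi a]. *)
Let phi1 : phi 1 = 1.
Proof.
have [a a0] := phi_neq0; apply: (mulIf a0).
by rewrite -phiM !mul1r.
Qed.

Let phiC r : phi (cst r) = r.
Proof.
rewrite -[RHS]mulr1 -phi1 -phiZ; congr phi.
by apply/funext => x; exact: esym (mulr1 _).
Qed.

Let U : set_system P := [set X | phi (indic X) = 1].

(** Multiplying by [indic X] leaves [phi] unchanged, since [phi (indic X) = 1], and erases all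
    values off [X]. *)
Let phi_eq_on X a b : U X -> (forall x, X x -> a x = b x) -> phi a = phi b.
Proof.
move=> UX ab; rewrite -[LHS]mul1r -[RHS]mul1r -UX -!phiM !indicM; congr phi.
by apply/funext => x; case: ifPn => // /set_mem /ab.
Qed.

Let phi_indicC X : phi (indic X) = 1 - phi (indic (~` X)).
Proof.
rewrite -phi1 -phiB; congr phi; apply/funext => x.
rewrite addrfctE opprfctE /indic in_setC.
by case: (x \in X); rewrite ?subr0 ?subrr.
Qed.

Let phi_set a : U [set x | a x = phi a].
Proof.
set Z := [set x | _]; rewrite /U /= phi_indicC.
suff -> : phi (indic (~` Z)) = 0 by rewrite subr0.
(* The second factor vanishes on [Z], so the value given to the inverse of 0 is harmless there;
   [phi] kills this factor. *)
have -> : indic (~` Z) = (fun x => (a x - phi a)^-1) * (a - cst (phi a)).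
  apply/funext => x; rewrite mulrfctE addrfctE opprfctE /indic in_setC.
  case: ifPn => [/negP xZ|/negPn/set_mem ->]; last by rewrite subrr mulr0.
  by rewrite mulVf// subr_eq0; apply/eqP => aE; apply/xZ/mem_set.
by rewrite phiM phiB phiC subrr mulr0.
Qed.

(** If the empty set were in [U], then [phi] would identify the constants 1 and 0. Intersections
    correspond to products of indicators. *)
Let U_proper : ProperFilter U.
Proof.
have US X Y : U X -> X `<=` Y -> U Y.
  move=> UX XY; rewrite /U /= -phi1; apply: phi_eq_on UX _ => x /XY Yx.
  by rewrite /indic mem_set.
split=> [U0|].
  have : phi (cst 1) = phi (cst 0) by apply: phi_eq_on U0 _.
  by rewrite !phiC => /eqP; rewrite oner_eq0.
split.
- rewrite /U /= -phi1; congr phi; apply/funext => x.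
  by rewrite /indic mem_set.
- move=> X Y UX UY; rewrite /U /=.
  rewrite -[RHS]mulr1 -{1}UX -UY -phiM indicM; congr phi.
  by apply/funext => x; rewrite /indic in_setI; case: (x \in X).
- by move=> X Y XY UX; apply: US XY.
Qed.

Lemma coord_proj_or_decisive :
  (exists x, forall a, phi a = a x) \/
  exists U : set_system P, nonprincipal_decisive R U.
Proof.
have [[x Ux]|Unp] := pselect (exists x, U [set x]).
  (* On the singleton of [x], the function [a] agrees with the constant [a x]. *)
  left; exists x => a; rewrite -[RHS]phiC.
  by apply: phi_eq_on Ux _ => _ ->.
right; exists U; split=> //.
  by move=> x Ux; apply: Unp; exists x.
by move=> a; exists (phi a); exact: phi_set.
Qed.

End Coordinate.

Lemma not_induced_decisive (R : fieldType) (P : Type) (eta : algEnd R P) :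
  ~ induced eta -> exists U : set_system P, nonprincipal_decisive R U.
Proof.
move=> nind; apply: contrapT => noU; apply: nind.
(* [A x] collects the coordinates at which [eta] is evaluation at [x]. They are disjoint for
   distinct points because the indicator of one point separates it from the other. *)
pose A x y := forall a : P -> R^o, eta a y = a x.
exists A; split.
  move=> x x' _ _ [y [xE x'E]]; apply: contrapT => nxx'.
  have := xE (indic R [set x]).
  rewrite x'E /indic (@mem_set _ _ x)// (@memNset _ _ x').
    by move=> /eqP; rewrite eq_sym oner_eq0.
  by move=> /= x'x; apply: nxx'.
move=> a y; split=> [x /(_ a)//|nA].
apply/eqP; apply: contrapT => /negP ay0; apply: nA.
have [[x xP]|//] := coord_proj_or_decisive (ex_intro _ a ay0).
by exists x.
Qed.

(** * Decisive filters and two-valued measures *)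

Lemma decisive_measure (R : fieldType) (P : Type) (U : set_system P) :
  nonprincipal_decisive R U -> carries_measure R P.
Proof.
move=> [FU Unp Udec].
pose mu X : \bar Rdefinitions.R := if pselect (U X) then 1%E else 0%E.
have mu1 X : U X -> mu X = 1%E by rewrite /mu; case: pselect.
have mu0 X : ~ U X -> mu X = 0%E by rewrite /mu; case: pselect.
exists mu; split.
- by move=> X; rewrite /mu; case: pselect; [right|left].
- by apply: mu1; exact: filterT.
- by move=> x; apply: mu0; exact: Unp.
move=> J I X /card_le_inj[f finj] disj.
have [UX|nUX] := pselect (U (\bigcup_(i in I) X i)); last first.
  rewrite mu0// esum1// => i Ii; apply: mu0 => UXi; apply: nUX.
  by apply: filterS UXi => x Xix; exists i.
have [i UXi] : exists i : I, U (X (val i)).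
  (* [a] labels each piece by its image under the injection [f]. The default 0 off the union may
     also be a label, so the fibre of [a] in [U] is intersected with the union before concluding
     that it lies in one piece. *)
  pose a x : R := if pselect (exists i : I, X (val i) x) is left h
                  then f (projT1 (cid h)) else 0.
  have aE (i : I) x : X (val i) x -> a x = f i.
    move=> Xix; rewrite /a; case: pselect => [h|[]]; last by exists i.
    case: cid => j Xjx /=; congr f; apply: val_inj.
    by apply: disj; [exact: set_valP|exact: set_valP|exists x].
  have [r Ur] := Udec a.
  have [x [[i0 Ii0 Xix] ax]] := filter_ex (filterI UX Ur).
  exists (SigSub (mem_set Ii0)); apply: filterS (filterI UX Ur).
  move=> z [[j Ij Xjz] az].
  suff /(congr1 val)/= <- : SigSub (mem_set Ij) = SigSub (mem_set Ii0) :> I.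
    by [].
  by apply: finj; rewrite -(aE _ z)// -(aE _ x)// az ax.
rewrite mu1// (@esum_unique _ _ _ _ (val i)) ?mu1//; first exact: set_valP.
move=> j Ij ji; apply: mu0 => UXj; apply: ji; apply: disj => //.
  exact: set_valP.
exact: filter_ex (filterI UXj UXi).
Qed.

Section MeasureFilter.
Variables (R : fieldType) (P : Type) (mu : set P -> \bar Rdefinitions.R).
Hypothesis mu_meas : nontrivial_succ_additive_measure R mu.

Let mu_bigcup1 (J : choiceType) (X : J -> set P) :
  [set: J] #<= [set: R] -> trivIset setT X ->
  mu (\bigcup_i X i) = 1%E -> exists i, mu (X i) = 1%E.
Proof.
case: mu_meas => mu01 _ _ muU JR disj; rewrite muU// => sum1.
apply: contrapT => /forallNP n1; move: sum1; rewrite esum1.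
  by move=> /esym/eqP; rewrite onee_eq0.
by move=> i _; have [//|/n1] := mu01 (X i).
Qed.

(** Since 0 and 1 differ in [R], additivity applies to partitions into two pieces. *)
Let bool_le : [set: bool] #<= [set: R].
Proof.
apply: (@inj_card_leT _ _ (fun b : bool => if b then 1 else 0 : R)).
by case=> -[] // /eqP; rewrite ?oner_eq0// eq_sym oner_eq0.
Qed.

Let muD (X Y : set P) : X `<=` Y -> mu Y = (mu X + mu (Y `\` X))%E.
Proof.
case: mu_meas => mu01 _ _ muU XY.
have mu_ge0 Z : (0 <= mu Z)%E by have [->|->] := mu01 Z.
have := muU bool setT (fun b => if b then X else Y `\` X) bool_le.
rewrite (esumID [set true])// setTI setTI.
rewrite (_ : ~` [set true] = [set false]); last first.
  by apply/seteqP; split=> -[] //= /(_ erefl).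
rewrite !esum_set1// => <-; first congr mu.
  apply/seteqP; split=> y => [Yy|]; last by move=> [[] _]; [exact: XY|case].
  by have [Xy|nXy] := pselect (X y); [exists true|exists false].
by move=> [] [] _ _ // [y []] => [Xy [_]|[_ nXy]].
Qed.

Let mu_split (X Y : set P) : X `<=` Y -> mu Y = 1%E ->
  (mu X = 1%E /\ mu (Y `\` X) = 0%E) \/ (mu X = 0%E /\ mu (Y `\` X) = 1%E).
Proof.
case: mu_meas => mu01 _ _ _ XY; rewrite (muD XY).
have [->|->] := mu01 X; have [->|->] := mu01 (Y `\` X); rewrite ?adde0 ?add0e.
- by move=> /esym/eqP; rewrite onee_eq0.
- by right.
- by left.
(* Both pieces having measure 1 would give 1 + 1 = 1. *)
- by move=> [] /eqP; rewrite -subr_eq0 addrK oner_eq0.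
Qed.

Lemma measure_decisive : nonprincipal_decisive R [set X | mu X = 1%E].
Proof.
case: mu_meas => mu01 muT mu_pt _.
have not01 X : mu X = 0%E -> mu X <> 1%E.
  by move=> -> /esym/eqP; rewrite onee_eq0.
have mu0 : mu set0 = 0%E.
  have [[_]|[//]] := mu_split (@sub0set _ setT) muT.
  by rewrite setD0 => /not01.
have muS X Y : X `<=` Y -> mu X = 1%E -> mu Y = 1%E.
  move=> XY X1; have [/= Y0|//] := mu01 Y.
  have := muD XY; rewrite Y0 X1; have [->|->] := mu01 (Y `\` X).
    by rewrite adde0 => /eqP; rewrite eq_sym onee_eq0.
  by move=> [] /eqP; rewrite eq_sym (@pnatr_eq0 _ 2).
split.
- split=> /=; first by apply: not01.
  split=> [//|X Y /= X1 Y1|X Y]; last exact: muS.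
  (* If the intersection had measure 0, its complement in [X] would have measure 1 while lying in
     the complement of [Y], which has measure 0. *)
  have [[]//|[I0 D1]] := mu_split (@subIsetl _ X Y) X1.
  have [[_]|[]] := mu_split (@subsetT _ Y) muT.
    move=> /not01 []; apply: muS D1 => z [Xz nXYz]; split=> // Yz.
    exact: nXYz.
  by move=> /not01.
- by move=> x; apply: not01.
(* The fibres of [a] partition [P] and are indexed by [R], so one of them has measure 1. *)
- move=> a; apply: mu_bigcup1 => //.
    by move=> r r' _ _ [x [<- <-]].
  rewrite -muT; congr mu; apply/seteqP; split=> // x _.
  by exists (a x).
Qed.

End MeasureFilter.

(** * The least cardinal carrying a measure *)

(** The measure is pushed forward along an injection. *)
Lemma carries_measure_le (K T T' : Type) :
  [set: T] #<= [set: T'] -> carries_measure K T -> carries_measure K T'.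
Proof.
move=> /card_leT_inj[f finj] [mu [mu01 muT mu_pt muU]].
(* The empty sum gives this value, which handles the points outside the range of [f]. *)
have mu0 : mu set0 = 0%E.
  have := muU nat set0 (fun=> set0); rewrite bigcup_set0 esum_set0; apply.
    exact: card_ge0.
  exact: trivIset_set0.
exists (fun X => mu (f @^-1` X)); split.
- by move=> X; exact: mu01.
- by rewrite preimage_setT.
- move=> t; have [[x fx]|nt] := pselect (exists x, f x = t).
    rewrite -(mu_pt x); congr mu; apply/seteqP; split=> [z /=|z ->//].
    by rewrite -fx => /finj.
  by rewrite -mu0; congr mu; apply/seteqP; split=> // z fz; apply: nt; exists z.
move=> J I X IK disj; rewrite preimage_bigcup; apply: muU => //.
by move=> i j Ii Ij [x Xx]; apply: disj => //; exists (f x).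
Qed.

(** [card_le_min] requires an indexed family, so the minimum is taken over subsets of [P]. A type
    [N] either is at least as large as [P] or injects into [P] and is replaced by its image. *)
Lemma exists_least_measure (K P : Type) : carries_measure K P ->
  exists S : set P, carries_measure K S /\
    forall N : Type, carries_measure K N -> [set: S] #<= [set: N].
Proof.
move=> mP.
have mT : carries_measure K [set: P].
  apply: carries_measure_le mP.
  by apply: (@inj_card_leT _ _ (fun x => SigSub (mem_setT x))) => x y [].
pose I := {S : set P | carries_measure K S}.
have [[S mS] Smin] :=
  card_le_min (exist _ [set: P] mT : I) (fun i : I => set_type (sval i)).
exists S; split=> // N mN.
have [PN|] := card_le_total P N.
  apply: card_le_trans PN.
  by apply: (@inj_card_leT _ _ val); exact: val_inj.
move=> /card_leT_inj[f finj].
have mf : carries_measure K (range f).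
  apply: carries_measure_le mN.
  apply: (@inj_card_leT _ _ (fun x => SigSub (mem_set (imageT f x)))).
  by move=> x y [] /finj.
have Sf : [set: S] #<= [set: range f] := Smin (exist _ (range f) mf).
apply: card_le_trans Sf _.
have preim (y : range f) : exists x, f x = val y.
  by have [x _ <-] := set_valP y; exists x.
have [g gP] := choice preim.
apply: (@inj_card_leT _ _ g) => y z e; apply: val_inj.
by rewrite -!gP e.
Qed.

(** * Decisive filters and infinite sets *)

Lemma filter_setC_bigcup (P : Type) (U : set_system P) (I : choiceType)
    (D : set I) (f : I -> set P) :
  Filter U -> finite_set D -> (forall i, D i -> U (~` f i)) ->
  U (~` \bigcup_(i in D) f i).
Proof.
move=> FU Dfin Uf.
have := @filter_bigI P I (fset_set D) (fun i => ~` f i) U FU.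
rewrite setC_bigcup fset_setK//; apply => i; rewrite in_fset_set// inE.
exact: Uf.
Qed.

Lemma decisive_infinite (R : fieldType) (P : Type) (U : set_system P) :
  nonprincipal_decisive R U -> infinite_set [set: P].
Proof.
(* On a finite [P], complements of points all lie in [U] and intersect in the empty set. [Pchoice]
   equips [P] with the choice structure used to index this intersection. *)
elim/Pchoice: P U => P U [FU Unp Udec] Pfin; apply: (filter_not_empty U).
have -> : set0 = ~` \bigcup_(x in [set: P]) [set x].
  by apply/esym; rewrite -subset0 => x; apply; exists x.
apply: filter_setC_bigcup => // x _.
pose e_x z : R := if z == x then 1 else 0.
have [r Ur] := Udec e_x.
(* The value 1 would put the singleton of [x] in [U]; any other value gives a fibre avoiding [x]. *)
have [r1|r1] := eqVneq r 1.
  exfalso; apply: (Unp x); apply: filterS Ur => z /=; rewrite r1 /e_x.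
  by case: eqP => // _ /esym/eqP; rewrite oner_eq0.
apply: filterS Ur => z /= + zx; rewrite /e_x zx eqxx => r1'.
by rewrite r1' eqxx in r1.
Qed.

(** An ultrafilter refining the cofinite filter works: were no fibre of [a] in it, it would contain
    the complements of these finitely many fibres, whose intersection is empty. *)
Lemma infinite_decisive (R : fieldType) (P : Type) :
  finite_set [set: R] -> infinite_set [set: P] ->
  exists U : set_system P, nonprincipal_decisive R U.
Proof.
move=> Rfin Pinf.
have cofF : ProperFilter [set X : set P | cofinite_set X].
  split; first by rewrite /= setC0.
  split=> [|X Y|X Y XY] /=.
  - by rewrite setCT; exact: finite_set0.
  - by rewrite setCI finite_setU.
  - by apply: sub_finite_set => x; apply: contra_not; exact: XY.
have [U [UU cofU]] := ultraFilterLemma cofF.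
exists U; split; first exact: ultra_proper.
  move=> x Ux; apply: (filter_not_empty U).
  rewrite -(setICr [set x]); apply: filterI => //.
  by apply: cofU; rewrite /= setCK; exact: finite_set1.
move=> a; apply: contrapT => /forallNP nU.
apply: (filter_not_empty U).
have -> : set0 = ~` \bigcup_(r in [set: R]) (a @^-1` [set r]).
  by apply/esym; rewrite -subset0 => x; apply; exists (a x).
apply: filter_setC_bigcup => // r _.
by have [/nU|] := in_ultra_setVsetC (a @^-1` [set r]) UU.
Qed.

(** * The equivalence with the cardinal bound *)

Theorem theorem3p28 (R : fieldType) (P : Type) :
  (forall eta : algEnd R P, induced eta) <-> card_lt_mu P R.
Proof.
split=> [all_ind M [Mfin Minf]|PltM eta].
  have noU (U : set_system P) : ~ nonprincipal_decisive R U.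
    by move=> Udec; exact: (ulim_const_not_induced (Udec := Udec)) (all_ind _).
  (* Cardinals are comparable, so it is enough to refute that [M] embeds in [P]. *)
  suff nMP : ~ ([set: M] #<= [set: P]).
    split; first by have [//|/nMP] := card_le_total P M.
    by rewrite card_eq_le => /andP[_ /nMP].
  have [Rfin|Rinf] := pselect (finite_set [set: R]).
    rewrite (card_le_eql (Mfin Rfin)) -infiniteP => Pinf.
    by have [U /noU] := infinite_decisive Rfin Pinf.
  have [mM _] := Minf Rinf.
  by move=> /carries_measure_le /(_ mM) [mu /measure_decisive /noU].
apply: contrapT => /not_induced_decisive[U Udec].
have [Rfin|Rinf] := pselect (finite_set [set: R]).
  (* For finite [R], the type [nat] represents the bound, so [P] would be finite. *)
  have [] : card_lt P nat by apply: PltM; split.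
  have /infiniteP Pinf := decisive_infinite Udec.
  by move=> Pnat; apply; rewrite card_eq_le Pnat.
(* The least [S] represents the bound, and being a subset of [P] it cannot be strictly larger than
   [P]. *)
have [S [mS Smin]] := exists_least_measure (decisive_measure Udec).
have [PS] : card_lt P S by apply: PltM; split.
apply; rewrite card_eq_le PS/=.
by apply: (@inj_card_leT _ _ val); exact: val_inj.
Qed.
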